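(* Let $G=(V,q)$ be a finite connected reversible graph with non-negative Ollivier curvature and invariant measure $m$. Let $\lambda_1$ be the smallest non-zero eigenvalue of $-\Delta$. Then \[ \lambda_1\le\frac{16\log 2}{q_{\min}}\,h^2. \]
   Context: A graph $G=(V,q)$: $V$ finite, $q:V\times V\to[0,\infty)$; Laplacian $\Delta f(x)=\sum_yq(x,y)(f(y)-f(x))$. Reversible with invariant measure $m:V\to(0,\infty)$: $q(x,y)m(x)=q(y,x)m(y)$ (so $-\Delta$ is self-adjoint on $\ell_2(V,m)$). $d$ is the combinatorial graph distance ($x\sim y$ iff $q(x,y)>0$). $q_{\min}=\min\{q(x,y):q(x,y)>0\}$. $|\partial A|=\sum_{x\in A}\sum_{y\in V\setminus A}m(x)q(x,y)$, $m(A)=\sum_{x\in A}m(x)$, and the Cheeger constant is $h=\inf\{|\partial A|/m(A):\ \emptyset\ne A\subset V,\ 2m(A)\le m(V)\}$. Ollivier curvature: for $x\ne y$, $\nabla_{xy}f=(f(x)-f(y))/d(x,y)$, $\|\nabla f\|_\infty=\sup_{x\ne y}|\nabla_{xy}f|$, $\kappa(x,y)=\inf\{\nabla_{xy}\Delta f:\|\nabla f\|_\infty=1,\ \nabla_{yx}f=1\}$; non-negative means $\kappa(x,y)\ge0$ for all $x\ne y$. *)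

(* Defs.v *)
From Stdlib Require Import Reals List Arith.
Import ListNotations.
Open Scope R_scope.

(* The vertex set V is {0, ..., n-1} (as naturals); functions on V are
   functions nat -> R whose values outside V are irrelevant. *)

Definition inV (n x : nat) : Prop := (x < n)%nat.

Definition sumV (n : nat) (f : nat -> R) : R :=
  fold_right Rplus 0 (map f (seq 0 n)).

Definition Lap (n : nat) (q : nat -> nat -> R) (f : nat -> R) (x : nat) : R :=
  sumV n (fun y => q x y * (f y - f x)).

Definition adjb (q : nat -> nat -> R) (x y : nat) : bool :=
  if Rlt_dec 0 (q x y) then true else false.

Fixpoint walkb (n : nat) (q : nat -> nat -> R) (k x y : nat) : bool :=
  match k with
  | O => Nat.eqb x y
  | S k' => existsb (fun z => andb (adjb q x z) (walkb n q k' z y)) (seq 0 n)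
  end.

(* combinatorial graph distance: least k with a walk of length k
   (in a connected graph on n vertices this is < n; default n otherwise) *)
Definition dist (n : nat) (q : nat -> nat -> R) (x y : nat) : nat :=
  match find (fun k => walkb n q k x y) (seq 0 n) with
  | Some k => k
  | None => n
  end.

Definition connected (n : nat) (q : nat -> nat -> R) : Prop :=
  forall x y, inV n x -> inV n y -> exists k, walkb n q k x y = true.

Definition grad (n : nat) (q : nat -> nat -> R) (x y : nat) (f : nat -> R) : R :=
  (f x - f y) / INR (dist n q x y).

(* ||nabla f||_oo = 1, i.e. sup_{x <> y} |nabla_{xy} f| = 1 (a max, V finite) *)
Definition grad_norm_one (n : nat) (q : nat -> nat -> R) (f : nat -> R) : Prop :=
  (forall a b, inV n a -> inV n b -> a <> b -> Rabs (grad n q a b f) <= 1) /\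
  (exists a b, inV n a /\ inV n b /\ a <> b /\ Rabs (grad n q a b f) = 1).

(* kappa(x,y) >= 0, where kappa(x,y) is the infimum of
   nabla_{xy} Delta f over f with ||nabla f||_oo = 1 and nabla_{yx} f = 1 *)
Definition kappa_nonneg_at (n : nat) (q : nat -> nat -> R) (x y : nat) : Prop :=
  forall f : nat -> R,
    grad_norm_one n q f -> grad n q y x f = 1 ->
    0 <= grad n q x y (Lap n q f).

Definition nonneg_ollivier (n : nat) (q : nat -> nat -> R) : Prop :=
  forall x y, inV n x -> inV n y -> x <> y -> kappa_nonneg_at n q x y.

Definition rates_nonneg (n : nat) (q : nat -> nat -> R) : Prop :=
  forall x y, inV n x -> inV n y -> 0 <= q x y.

Definition reversible (n : nat) (q : nat -> nat -> R) (m : nat -> R) : Prop :=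
  (forall x, inV n x -> 0 < m x) /\
  (forall x y, inV n x -> inV n y -> q x y * m x = q y x * m y).

Definition is_inf (P : R -> Prop) (r : R) : Prop :=
  (forall s, P s -> r <= s) /\ (forall e, (forall s, P s -> e <= s) -> e <= r).

Definition is_qmin (n : nat) (q : nat -> nat -> R) (r : R) : Prop :=
  is_inf (fun s => exists x y, inV n x /\ inV n y /\ 0 < q x y /\ s = q x y) r.

Definition mass (n : nat) (m : nat -> R) (A : nat -> bool) : R :=
  sumV n (fun x => if A x then m x else 0).

Definition boundary (n : nat) (q : nat -> nat -> R) (m : nat -> R) (A : nat -> bool) : R :=
  sumV n (fun x => if A x then sumV n (fun y => if A y then 0 else m x * q x y) else 0).

Definition is_cheeger (n : nat) (q : nat -> nat -> R) (m : nat -> R) (h : R) : Prop :=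
  is_inf (fun s => exists A : nat -> bool,
            (exists x, inV n x /\ A x = true) /\
            2 * mass n m A <= sumV n m /\
            s = boundary n q m A / mass n m A) h.

Definition is_eigenvalue (n : nat) (q : nat -> nat -> R) (lam : R) : Prop :=
  exists f : nat -> R, (exists x, inV n x /\ f x <> 0) /\
    forall x, inV n x -> - Lap n q f x = lam * f x.

Definition is_lambda1 (n : nat) (q : nat -> nat -> R) (lam : R) : Prop :=
  is_eigenvalue n q lam /\ lam <> 0 /\
  forall mu, is_eigenvalue n q mu -> mu <> 0 -> lam <= mu.

(* Main.v *)
From Stdlib Require Import Reals RList List Arith Lia Psatz Classical.
From mathcomp Require all_boot all_algebra Rstruct.
Require Import Defs.
Open Scope R_scope.

(** Instead of the heat semigroup one resolvent suffices. Given [A], let [u] solve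
    [lam u - Lap u = lam 1_A]. Comparing [u x - u y] with the modulus [1 - r ^ dist x y],
    where [2 qmin (1 - r)^2 = lam r], at a pair [(x, y)] where the excess is maximal,
    non-negative curvature forces [u x - u y <= 1 - r <= sqrt (lam / (2 qmin))] along
    edges. Hence the Dirichlet form of [u] and [1_A] is at most
    [sqrt (lam / (2 qmin)) * |dA|]. It equals [lam <1_A - u, 1_A>], which for [lam = lam1]
    and [2 m(A) <= m(V)] is at least [lam m(A) / 4] by the Poincare inequality. This gives
    [lam1 <= 8 h^2 / qmin], and [8 <= 16 ln 2]. *)

(** * Sums and linear algebra *)

Lemma sumV_S n f : sumV (S n) f = sumV n f + f n.
Proof.
  unfold sumV. rewrite seq_S, map_app, fold_right_app. cbn.
  rewrite Rplus_0_r. generalize (f n) as c. generalize (map f (seq 0 n)).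
  induction l as [|a l IH]; intros c; cbn; [lra|]. rewrite IH. lra.
Qed.

Lemma sumV_ext n f g : (forall x, inV n x -> f x = g x) -> sumV n f = sumV n g.
Proof.
  unfold inV. induction n as [|n IH]; intros H; [reflexivity|].
  rewrite !sumV_S, IH, (H n); auto with arith.
Qed.

Lemma sumV_le n f g : (forall x, inV n x -> f x <= g x) -> sumV n f <= sumV n g.
Proof.
  unfold inV. induction n as [|n IH]; intros H; [cbn; lra|].
  rewrite !sumV_S. apply Rplus_le_compat; auto with arith.
Qed.

Lemma sumV_plus n f g : sumV n (fun x => f x + g x) = sumV n f + sumV n g.
Proof. induction n as [|n IH]; [cbn; lra|]. rewrite !sumV_S, IH. lra. Qed.

Lemma sumV_scal n c f : sumV n (fun x => c * f x) = c * sumV n f.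
Proof. induction n as [|n IH]; [cbn; lra|]. rewrite !sumV_S, IH. lra. Qed.

Lemma sumV_minus n f g : sumV n (fun x => f x - g x) = sumV n f - sumV n g.
Proof. induction n as [|n IH]; [cbn; lra|]. rewrite !sumV_S, IH. lra. Qed.

Lemma sumV_lin n a b f g :
  sumV n (fun x => a * f x + b * g x) = a * sumV n f + b * sumV n g.
Proof. now rewrite sumV_plus, !sumV_scal. Qed.

Lemma sumV_0 n : sumV n (fun _ => 0) = 0.
Proof. induction n as [|n IH]; [reflexivity|]. rewrite sumV_S, IH. lra. Qed.

Lemma sumV_eq0 n f : (forall x, inV n x -> f x = 0) -> sumV n f = 0.
Proof. intros H. rewrite <- (sumV_0 n). now apply sumV_ext. Qed.

Lemma sumV_nonneg n f : (forall x, inV n x -> 0 <= f x) -> 0 <= sumV n f.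
Proof. intros H. rewrite <- (sumV_0 n). now apply sumV_le. Qed.

Lemma sumV_swap n k (F : nat -> nat -> R) :
  sumV n (fun x => sumV k (fun y => F x y)) = sumV k (fun y => sumV n (fun x => F x y)).
Proof.
  induction n as [|n IH]; [cbn; now rewrite sumV_0|].
  rewrite sumV_S, IH, <- sumV_plus. apply sumV_ext; intros y _. now rewrite sumV_S.
Qed.

Lemma sumV_delta n i f : inV n i -> sumV n (fun j => if Nat.eqb j i then f j else 0) = f i.
Proof.
  unfold inV. induction n as [|n IH]; intros H; [lia|]. rewrite sumV_S.
  destruct (Nat.eqb_spec n i) as [->|ne].
  - rewrite (sumV_ext _ _ (fun _ => 0)), sumV_0; [lra|].
    intros x hx. unfold inV in hx. destruct (Nat.eqb_spec x i); [lia|reflexivity].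
  - rewrite IH; [lra|lia].
Qed.

Lemma sumV_term_le n f i :
  (forall x, inV n x -> 0 <= f x) -> inV n i -> f i <= sumV n f.
Proof.
  intros H hi. rewrite <- (sumV_delta n i f hi). apply sumV_le. intros x hx.
  destruct (Nat.eqb x i); [lra|auto].
Qed.

Lemma argmax (T : Type) (l : list T) (g : T -> R) :
  l <> nil -> exists a, In a l /\ forall b, In b l -> g b <= g a.
Proof.
  induction l as [|a l IH]; [congruence|]. intros _. destruct l as [|a' l'].
  - exists a. split; [now left|]. intros b [->|[]]. lra.
  - destruct IH as [c [hc Hc]]; [discriminate|].
    destruct (Rle_dec (g a) (g c)) as [h|h].
    + exists c. split; [now right|]. intros b [->|hb]; auto.
    + exists a. split; [now left|]. intros b [->|hb]; [lra|].
      specialize (Hc b hb). lra.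
Qed.

(** * Inverting square matrices *)

Module LinAlg.
#[local] Set Warnings "-notation-overridden,-ambiguous-paths".
Import all_boot all_algebra Rstruct.
Import GRing.Theory.

Lemma sumV_bigE n (f : nat -> R) : sumV n f = (\sum_(i < n) f i)%R.
Proof.
rewrite /sumV -(big_mkord xpredT) unlock /reducebig /index_iota subn0.
have -> : List.seq 0 n = iota 0 n by elim: n 0%N => //= n IH k; rewrite IH.
by elim: (iota 0 n) => //= k s ->.
Qed.

(** Over a field, a square matrix with trivial kernel is invertible. The inverse is delivered as a
    kernel on naturals, so that all later arguments stay within [sumV]. *)
Lemma right_inverse n (A : nat -> nat -> R) :
  (forall f, (forall i, inV n i -> sumV n (fun j => Rmult (A i j) (f j)) = 0%R) ->
    forall i, inV n i -> f i = 0%R) ->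
  exists B : nat -> nat -> R, forall g i, inV n i ->
    sumV n (fun j => Rmult (A i j) (sumV n (fun k => Rmult (B j k) (g k)))) = g i.
Proof.
case: n => [|n] injA; first by exists (fun _ _ => R0) => g i /ltP.
pose M : 'M[R]_n.+1 := (\matrix_(i, j) A i j)%R.
have uM : M \in unitmx.
  (* It suffices that the transpose of [M] kills no nonzero row vector; read as a function, such a
     row lies in the kernel of [A]. *)
  rewrite -unitmx_tr -row_free_unit -kermx_eq0; apply/eqP/row_matrixP => r.
  rewrite row0; set v := row r _.
  have vM : (v *m M^T = 0)%R by rewrite /v -row_mul mulmx_ker row0.
  apply/rowP => j; rewrite [RHS]mxE.
  have := injA (fun k => v ord0 (inord k)) _ j (elimT ltP (ltn_ord j)).
  rewrite inord_val; apply => i /ltP lti.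
  rewrite sumV_bigE; have /matrixP/(_ ord0 (Ordinal lti)) := vM.
  rewrite !mxE => e; rewrite -[RHS]e; apply: eq_bigr => k _.
  by rewrite !mxE inord_val mulrC.
exists (fun j k => invmx M (inord j) (inord k)) => g i /ltP lti.
pose G : 'cV[R]_n.+1 := (\col_k g k)%R.
have /matrixP/(_ (Ordinal lti) ord0) : (M *m (invmx M *m G) = G)%R by rewrite mulKVmx.
rewrite sumV_bigE !mxE /= => e; rewrite -[RHS]e; apply: eq_bigr => j _.
rewrite sumV_bigE !mxE; congr Rmult; apply: eq_bigr => k _.
by rewrite !mxE !inord_val.
Qed.
End LinAlg.

(** * Graph distance *)

Lemma adjbP q x y : adjb q x y = true <-> 0 < q x y.
Proof. unfold adjb. destruct (Rlt_dec 0 (q x y)); split; congruence. Qed.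

Lemma walkb_S n q k x y :
  walkb n q (S k) x y = true <->
  exists z, inV n z /\ 0 < q x z /\ walkb n q k z y = true.
Proof.
  cbn. rewrite existsb_exists. split.
  - intros [z [hz h]]. apply in_seq in hz. apply Bool.andb_true_iff in h.
    rewrite adjbP in h. exists z. unfold inV. intuition lia.
  - intros [z [hz [h1 h2]]]. unfold inV in hz. exists z. rewrite in_seq, h2.
    apply adjbP in h1. rewrite h1. split; [lia|reflexivity].
Qed.

Lemma walkb_app n q j k x y z :
  walkb n q j x y = true -> walkb n q k y z = true -> walkb n q (j + k) x z = true.
Proof.
  revert x. induction j as [|j IH]; intros x h1 h2.
  - cbn in h1. apply Nat.eqb_eq in h1. now subst.
  - apply walkb_S in h1. destruct h1 as [w [hw [a b]]].
    apply (proj2 (walkb_S n q (j + k) x z)). eauto.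
Qed.

(* A shortest walk visits vertices at pairwise distinct distances to its end point. *)
Lemma shortest_walk_vertices n q k x y :
  inV n x -> walkb n q k x y = true ->
  (forall j, (j < k)%nat -> walkb n q j x y = false) ->
  exists l, length l = S k /\ NoDup l /\ incl l (seq 0 n) /\
    forall z, In z l -> exists j, (j <= k)%nat /\ walkb n q j z y = true.
Proof.
  revert x. induction k as [|k IH]; intros x hx hw hmin.
  - exists (x :: nil). repeat split.
    + constructor; [easy|constructor].
    + intros z [<-|[]]. apply in_seq. unfold inV in hx. lia.
    + intros z [<-|[]]. eauto.
  - destruct (proj1 (walkb_S n q k x y) hw) as [w [hwV [hxw hwy]]].
    destruct (IH w hwV hwy) as [l [hl [hnd [hin hd]]]].
    { intros j hj. destruct (walkb n q j w y) eqn:E; [|reflexivity].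
      rewrite <- (hmin (S j)) by lia. symmetry. apply walkb_S. eauto. }
    exists (x :: l). repeat split.
    + cbn. now rewrite hl.
    + constructor; [|assumption]. intros hc. destruct (hd x hc) as [j [hj h]].
      rewrite hmin in h; [discriminate|lia].
    + intros z [<-|hz]; [|auto]. apply in_seq. unfold inV in hx. lia.
    + intros z [<-|hz]; [eauto|]. destruct (hd z hz) as [j [hj h]]. exists j. split; [lia|assumption].
Qed.

Lemma least_true (p : nat -> bool) k :
  p k = true -> exists j, (j <= k)%nat /\ p j = true /\ forall i, (i < j)%nat -> p i = false.
Proof.
  induction k as [k IH] using lt_wf_ind. intros hk.
  destruct (existsb p (seq 0 k)) eqn:E.
  - apply existsb_exists in E. destruct E as [i [hi hp]]. apply in_seq in hi.
    destruct (IH i) as [j [? ?]]; [lia|assumption|]. exists j. split; [lia|assumption].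
  - exists k. repeat split; [lia|assumption|]. intros i hi.
    destruct (p i) eqn:Ei; [|reflexivity].
    rewrite <- E. symmetry. apply existsb_exists. exists i. split; [apply in_seq; lia|assumption].
Qed.

Lemma find_seq_least (p : nat -> bool) n j :
  (j < n)%nat -> p j = true -> (forall i, (i < j)%nat -> p i = false) ->
  find p (seq 0 n) = Some j.
Proof.
  intros hj hp hmin. replace n with (j + S (n - S j))%nat by lia.
  rewrite seq_app. cbn [seq Nat.add].
  assert (H : forall l, (forall i, In i l -> p i = false) ->
            forall r, find p (l ++ j :: r) = Some j).
  { induction l as [|a l IH]; intros Hl r; cbn.
    - now rewrite hp.
    - rewrite (Hl a) by now left. apply IH. intros i hi. apply Hl. now right. }
  apply H. intros i hi. apply in_seq in hi. apply hmin. lia.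
Qed.

(** A shortest walk of length [j] visits [S j] distinct vertices out of [n], so [j < n]. The search
    in [dist] therefore succeeds and never falls back on its default [n]. *)
Lemma dist_spec n q x y :
  connected n q -> inV n x -> inV n y ->
  walkb n q (dist n q x y) x y = true /\
  forall k, walkb n q k x y = true -> (dist n q x y <= k)%nat.
Proof.
  intros hc hx hy. destruct (hc x y hx hy) as [k hk].
  destruct (least_true (fun k => walkb n q k x y) k hk) as [j [_ [hj hmin]]].
  destruct (shortest_walk_vertices n q j x y hx hj hmin) as [l [hl [hnd [hin _]]]].
  assert (hlt := NoDup_incl_length hnd hin). rewrite hl, length_seq in hlt.
  assert (E : dist n q x y = j).
  { unfold dist. rewrite (find_seq_least _ n j); [reflexivity|lia|assumption|assumption]. }
  rewrite E. split; [assumption|]. intros i hi.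
  destruct (le_lt_dec j i) as [|hlt']; [assumption|]. rewrite hmin in hi; easy.
Qed.

Section Distance.
Context (n : nat) (q : nat -> nat -> R) (hc : connected n q).
Notation d := (dist n q).

Lemma dist_le x y k : inV n x -> inV n y -> walkb n q k x y = true -> (d x y <= k)%nat.
Proof. intros hx hy. now apply dist_spec. Qed.

Lemma dist_refl x : inV n x -> d x x = 0%nat.
Proof. intros hx. cut (d x x <= 0)%nat; [lia|]. apply dist_le; auto. cbn. apply Nat.eqb_refl. Qed.

Lemma dist_pos x y : inV n x -> inV n y -> x <> y -> (0 < d x y)%nat.
Proof.
  intros hx hy ne. destruct (dist_spec n q x y hc hx hy) as [h _].
  destruct (d x y); [|lia]. cbn in h. apply Nat.eqb_eq in h. contradiction.
Qed.

Lemma dist_triangle x y z : inV n x -> inV n y -> inV n z -> (d x z <= d x y + d y z)%nat.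
Proof.
  intros hx hy hz. apply dist_le; auto.
  apply walkb_app with y; now apply dist_spec.
Qed.

Lemma dist_adj x y : inV n x -> inV n y -> 0 < q x y -> (d x y <= 1)%nat.
Proof.
  intros hx hy h. apply dist_le; auto. apply walkb_S. exists y. cbn. rewrite Nat.eqb_refl. auto.
Qed.

Lemma dist_descend x y : inV n x -> inV n y -> x <> y ->
  exists z, inV n z /\ 0 < q x z /\ S (d z y) = d x y.
Proof.
  intros hx hy ne. pose proof (dist_pos x y hx hy ne) as hp.
  destruct (dist_spec n q x y hc hx hy) as [h _].
  destruct (d x y) as [|k] eqn:E; [lia|]. apply walkb_S in h.
  destruct h as [z [hz [hq hw]]]. exists z. repeat split; auto.
  pose proof (dist_le z y k hz hy hw). pose proof (dist_triangle x z y hx hz hy).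
  pose proof (dist_adj x z hx hz hq). lia.
Qed.

Context (hsym : forall x y, inV n x -> inV n y -> 0 < q x y -> 0 < q y x).

Lemma walkb_sym k x y : inV n x -> inV n y -> walkb n q k x y = true -> walkb n q k y x = true.
Proof.
  revert x. induction k as [|k IH]; intros x hx hy h.
  - cbn in *. now rewrite Nat.eqb_sym.
  - apply walkb_S in h. destruct h as [z [hz [hq hw]]].
    rewrite <- Nat.add_1_r. apply walkb_app with z; [auto|].
    apply walkb_S. exists x. cbn. rewrite Nat.eqb_refl. auto.
Qed.

Lemma dist_sym x y : inV n x -> inV n y -> d x y = d y x.
Proof.
  intros hx hy. apply Nat.le_antisymm; apply dist_le; auto; apply walkb_sym; auto; now apply dist_spec.
Qed.
End Distance.

(** * Curvature and the modulus of continuity of resolvents *)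

Lemma pow_le_one r k : 0 < r < 1 -> r ^ k <= 1.
Proof. intros hr. rewrite <- (pow1 k). apply pow_incr. lra. Qed.

Lemma one_minus_pow_le r k : 0 < r < 1 -> 1 - r ^ k <= (1 - r) * INR k.
Proof.
  intros hr. induction k as [|k IH]; [cbn; lra|]. rewrite S_INR. cbn.
  assert (r ^ k <= 1) by now apply pow_le_one.
  nra.
Qed.

(** [1 - r ^ S k] is [1 - r] times a geometric sum of [S k] terms, the smallest of which is
    [r ^ k]. *)
Lemma one_minus_pow_ge r k : 0 < r < 1 -> r ^ k * (1 - r) * INR (S k) <= 1 - r ^ S k.
Proof.
  intros hr. induction k as [|k IH]; [cbn; lra|].
  rewrite <- (tech_pow_Rmult r k), <- (tech_pow_Rmult r (S k)), (S_INR (S k)).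
  rewrite <- (tech_pow_Rmult r k) in *.
  assert (0 < r ^ k) by (apply pow_lt; lra).
  assert (r ^ k <= 1) by now apply pow_le_one.
  assert (0 <= (1 - r) * (1 - r * r ^ k)) by (apply Rmult_le_pos; nra).
  apply Rmult_le_compat_l with (r := r) in IH; [|lra]. lra.
Qed.

(* [1 - r ^ k] is concave in [k]: it lies below its two one-sided tangents at [S D]. *)
Lemma geometric_tangents r D k : 0 < r < 1 ->
  r ^ S D - r ^ k <= r ^ D * (1 - r) * (INR k - INR (S D)) /\
  r ^ S D - r ^ k <= r ^ S D * (1 - r) * (INR k - INR (S D)).
Proof.
  intros hr.
  assert (p0 : 0 < r ^ D) by (apply pow_lt; lra).
  destruct (le_lt_dec (S D) k) as [h|h].
  - replace k with (S D + (k - S D))%nat by lia. generalize (k - S D)%nat as j. intros j.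
    rewrite pow_add, plus_INR, <- tech_pow_Rmult.
    pose proof (one_minus_pow_le r j hr). assert (0 <= INR j) by apply pos_INR.
    assert (0 < r * r ^ D) by nra.
    assert (r * r ^ D * (1 - r ^ j) <= r * r ^ D * ((1 - r) * INR j)) by (apply Rmult_le_compat_l; lra).
    assert (0 <= (1 - r) * INR j) by nra.
    assert (0 <= r ^ D * ((1 - r) * ((1 - r) * INR j))) by (apply Rmult_le_pos; nra).
    split; nra.
  (* To the left of [S D] the gap is [S j], hence at least one, as [one_minus_pow_ge] requires. *)
  - set (j := (D - k)%nat). assert (E : D = (k + j)%nat) by lia. rewrite E.
    replace (S (k + j)) with (k + S j)%nat by lia.
    rewrite !pow_add, plus_INR.
    pose proof (one_minus_pow_ge r j hr) as hj. assert (0 < INR (S j)) by (apply lt_0_INR; lia).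
    assert (pk : 0 < r ^ k) by (apply pow_lt; lra).
    assert (pj : 0 < r ^ j) by (apply pow_lt; lra).
    assert (h1 : r ^ k * (r ^ j * (1 - r) * INR (S j)) <= r ^ k * (1 - r ^ S j))
      by (apply Rmult_le_compat_l; lra).
    split; [nra|]. rewrite <- (tech_pow_Rmult r j) in *.
    assert (0 <= r ^ k * (r ^ j * (1 - r) * INR (S j))) by (repeat apply Rmult_le_pos; lra).
    nra.
Qed.

Section Curvature.
Context (n : nat) (q : nat -> nat -> R) (hq : rates_nonneg n q) (hc : connected n q)
  (hsym : forall x y, inV n x -> inV n y -> 0 < q x y -> 0 < q y x)
  (hk : nonneg_ollivier n q).
Notation d := (dist n q).

Lemma INR_dist_pos x y : inV n x -> inV n y -> x <> y -> 0 < INR (d x y).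
Proof. intros. apply lt_0_INR. now apply dist_pos. Qed.

(** The curvature hypothesis in the form used below. It is applied to the pair [(y, x)] and to [f]
    rescaled by [/ b], which has gradient norm one, attained at [(x, y)]. *)
Lemma Lap_le_of_lipschitz b f x y :
  0 < b -> inV n x -> inV n y -> x <> y ->
  (forall v w, inV n v -> inV n w -> f v - f w <= b * INR (d v w)) ->
  f x - f y = b * INR (d x y) ->
  Lap n q f x <= Lap n q f y.
Proof.
  intros hb hx hy ne hL hE. set (g := fun z => / b * f z).
  assert (gE : grad n q x y g = 1).
  { unfold grad, g. rewrite <- Rmult_minus_distr_l, hE. field.
    pose proof (INR_dist_pos x y hx hy ne). lra. }
  assert (hn : grad_norm_one n q g).
  { split.
    - intros v w hv hw nvw. unfold grad, g. pose proof (INR_dist_pos v w hv hw nvw) as hp.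
      rewrite <- Rmult_minus_distr_l. apply Rabs_le.
      pose proof (hL v w hv hw) as h1. pose proof (hL w v hw hv) as h2.
      rewrite (dist_sym n q hc hsym w v) in h2 by assumption.
      replace (/ b * (f v - f w) / INR (d v w)) with ((f v - f w) / (b * INR (d v w)))
        by (field; lra).
      assert (hbp : 0 < b * INR (d v w)) by now apply Rmult_lt_0_compat.
      split; apply (Rmult_le_reg_r (b * INR (d v w))); auto; unfold Rdiv;
        rewrite Rmult_assoc, Rinv_l by lra; lra.
    - exists x, y. rewrite gE, Rabs_R1. auto. }
  assert (H := hk y x hy hx (not_eq_sym ne) g hn gE).
  unfold grad in H. pose proof (INR_dist_pos y x hy hx (not_eq_sym ne)) as hp.
  assert (LE : forall z, Lap n q g z = / b * Lap n q f z).
  { intros z. unfold Lap. rewrite <- sumV_scal. apply sumV_ext; intros w _. unfold g. ring. }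
  rewrite !LE, <- Rmult_minus_distr_l in H.
  apply Rnot_lt_le. intros hlt. revert H. apply Rlt_not_le.
  assert (0 < / b * (Lap n q f x - Lap n q f y) / INR (d y x)).
  { apply Rmult_lt_0_compat; [apply Rmult_lt_0_compat|]; try apply Rinv_0_lt_compat; lra. }
  unfold Rdiv in *. lra.
Qed.

(* Infinitesimal transport along the geodesic steps [x -> x'] and [y -> y'], in dual
   form: decoupling these steps from the optimal plan keeps the mean distance from
   growing, so each of them strictly decreases the distance. On the dual side the
   potentials [u - u x] near [x] and [u - u y] near [y] remain compatible with the cost
   [b * (d v w - d x y)] after being shifted by [a - b] at [x'] and at [y']. *)
Lemma Lap_touching a b u x y x' y' :
  0 < b <= a -> inV n x -> inV n y -> x <> y ->
  (forall v w, inV n v -> inV n w ->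
    u v - u w - (u x - u y) <= a * (INR (d v w) - INR (d x y))) ->
  (forall v w, inV n v -> inV n w ->
    u v - u w - (u x - u y) <= b * (INR (d v w) - INR (d x y))) ->
  inV n x' -> 0 < q x x' -> S (d x' y) = d x y ->
  inV n y' -> 0 < q y y' -> S (d y' x) = d x y ->
  Lap n q u x - Lap n q u y <= - (a - b) * (q x x' + q y y').
Proof.
  intros hab hx hy ne Ha Hb hx' qx' dx' hy' qy' dy'.
  set (D := d x y) in *.
  set (e := a - b).
  assert (he : 0 <= e) by (unfold e; lra).
  set (F := fun v => u v - u x + (if Nat.eqb v x' then e else 0)).
  set (G := fun w => u w - u y - (if Nat.eqb w y' then e else 0)).
  (* A step to [x'] or to [y'] shortens the distance by exactly one, so slope [a] forces increments
     of size at least [a] there. Single steps in general lengthen it by at most one, and slope [b]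
     then gives [pv] and [rw]. *)
  assert (px' : u x' - u x <= - a).
  { specialize (Ha x' y hx' hy). rewrite <- dx', S_INR in Ha. lra. }
  assert (ry' : a <= u y' - u y).
  { specialize (Ha x y' hx hy'). rewrite (dist_sym n q hc hsym x y'), <- dy', S_INR in Ha; auto. lra. }
  assert (pv : forall v, inV n v -> (d x v <= 1)%nat -> u v - u x <= b).
  { intros v hv hd. specialize (Hb v y hv hy).
    pose proof (dist_triangle n q hc v x y hv hx hy) as ht.
    rewrite (dist_sym n q hc hsym v x hv hx) in ht.
    assert (hle : (d v y <= S D)%nat) by (unfold D; lia). apply le_INR in hle. rewrite S_INR in hle. nra. }
  assert (rw : forall w, inV n w -> (d y w <= 1)%nat -> - b <= u w - u y).
  { intros w hw hd. specialize (Hb x w hx hw).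
    pose proof (dist_triangle n q hc x y w hx hy hw) as ht.
    assert (hle : (d x w <= S D)%nat) by (unfold D; lia). apply le_INR in hle. rewrite S_INR in hle. nra. }
  assert (FG : forall v w, inV n v -> inV n w -> (d x v <= 1)%nat -> (d y w <= 1)%nat ->
    F v - G w <= b * (INR (d v w) - INR D)).
  { intros v w hv hw dv dw. unfold F, G.
    specialize (Ha v w hv hw). specialize (Hb v w hv hw).
    specialize (pv v hv dv). specialize (rw w hw dw).
    destruct (Nat.eqb_spec v x') as [->|nv], (Nat.eqb_spec w y') as [->|nw].
    (* With both shifts present, the left side is at most [- 2 * a + 2 * e = - 2 * b], while the
       distance has dropped by at most two. *)
    - assert (hle : (D <= S (S (d x' y')))%nat).
      { pose proof (dist_triangle n q hc x x' y hx hx' hy).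
        pose proof (dist_triangle n q hc x' y' y hx' hy' hy).
        rewrite (dist_sym n q hc hsym y' y hy' hy) in *. unfold D. lia. }
      apply le_INR in hle. rewrite !S_INR in hle. unfold e. nra.
    - pose proof (dist_triangle n q hc x' y w hx' hy hw).
      (* Here [d x' w] is at most [D]. If it equals [D], the bounds [- a] and [b] on the two
         increments absorb [e] exactly; if it is smaller, replacing slope [a] by [b] over at least
         one unit pays for [e = a - b]. *)
      destruct (Nat.eq_dec (d x' w) D) as [E|E].
      + rewrite E. unfold e. lra.
      + assert (hle : (S (d x' w) <= D)%nat) by lia.
        apply le_INR in hle. rewrite S_INR in hle. unfold e in *. nra.
    - pose proof (dist_triangle n q hc y' x v hy' hx hv).
      rewrite (dist_sym n q hc hsym y' v hy' hv) in *.
      destruct (Nat.eq_dec (d v y') D) as [E|E].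
      + rewrite E. unfold e. lra.
      + assert (hle : (S (d v y') <= D)%nat) by lia.
        apply le_INR in hle. rewrite S_INR in hle. unfold e in *. nra.
    - lra. }
  set (B := filter (fun v => Nat.leb (d x v) 1) (seq 0 n)).
  assert (BE : forall v, In v B <-> inV n v /\ (d x v <= 1)%nat).
  { intros v. unfold B. rewrite filter_In, in_seq, Nat.leb_le. unfold inV. intuition lia. }
  assert (xB : In x B) by (apply BE; rewrite dist_refl; auto).
  (* McShane extension: the least function with Lipschitz constant [b] that dominates [F + b * D] on
     the unit ball around [x]. By [FG] it stays below [G] on the unit ball around [y]. *)
  set (f := fun z => MaxRlist (map (fun v => F v + b * (INR D - INR (d v z))) B)).
  assert (f_ge : forall v z, In v B -> F v + b * (INR D - INR (d v z)) <= f z).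
  { intros v z hv. apply MaxRlist_P1. apply in_map_iff. eauto. }
  assert (f_at : forall z, exists v, In v B /\ f z = F v + b * (INR D - INR (d v z))).
  { intros z. assert (h : In (f z) (map (fun v => F v + b * (INR D - INR (d v z))) B)).
    { apply MaxRlist_P2. eexists. apply in_map. exact xB. }
    apply in_map_iff in h. destruct h as [v [h1 h2]]. eauto. }
  assert (fL : forall z t, inV n z -> inV n t -> f z - f t <= b * INR (d z t)).
  { intros z t hz ht. destruct (f_at z) as [v [hv ->]]. pose proof (f_ge v t hv) as h.
    apply BE in hv. destruct hv as [hv _].
    pose proof (dist_triangle n q hc v z t hv hz ht) as tr. apply le_INR in tr.
    rewrite plus_INR in tr. nra. }
  assert (f_le_G : forall w, inV n w -> (d y w <= 1)%nat -> f w <= G w).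
  { intros w hw dw. destruct (f_at w) as [v [hv ->]]. apply BE in hv.
    specialize (FG v w (proj1 hv) hw (proj2 hv) dw). lra. }
  assert (F_le_f : forall v, inV n v -> (d x v <= 1)%nat -> F v + b * INR D <= f v).
  { intros v hv dv. pose proof (f_ge v v (proj2 (BE v) (conj hv dv))) as h.
    rewrite dist_refl in h by assumption. cbn [INR] in h. lra. }
  assert (Fx : F x = 0).
  { unfold F. destruct (Nat.eqb_spec x x') as [<-|]; [unfold D in dx'; lia|lra]. }
  assert (Gy : G y = 0).
  { unfold G. destruct (Nat.eqb_spec y y') as [<-|]; [|lra].
    rewrite (dist_sym n q hc hsym y x hy hx) in dy'. unfold D in dy'; lia. }
  pose proof (F_le_f x hx) as fx. rewrite dist_refl, Fx in fx by assumption.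
  pose proof (f_le_G y hy) as fy. rewrite dist_refl, Gy in fy by assumption.
  specialize (fx ltac:(lia)). specialize (fy ltac:(lia)).
  pose proof (fL x y hx hy) as fxy. fold D in fxy.
  (* The bounds at [x] and [y] together with the Lipschitz bound force [f x = b * D] and [f y = 0],
     so the pair is saturated. *)
  assert (H : Lap n q f x <= Lap n q f y) by (apply (Lap_le_of_lipschitz b); auto; fold D; lra).
  (* Every vertex with positive rate from [x] lies in the unit ball, where [f v - f x] is at least
     [F v]; the shift in [F] contributes [e * q x x']. The estimate at [y] is the mirror image with
     [G]. *)
  assert (Hx : Lap n q u x + e * q x x' <= Lap n q f x).
  { replace (e * q x x') with (sumV n (fun v => if Nat.eqb v x' then e * q x v else 0))
      by (now rewrite sumV_delta).
    unfold Lap. rewrite <- sumV_plus. apply sumV_le. intros v hv.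
    destruct (hq x v hx hv) as [hp|hz]; [|rewrite <- hz; destruct (Nat.eqb v x'); lra].
    specialize (F_le_f v hv (dist_adj n q hc x v hx hv hp)). unfold F in F_le_f.
    destruct (Nat.eqb v x'); nra. }
  assert (Hy : Lap n q f y <= Lap n q u y - e * q y y').
  { replace (e * q y y') with (sumV n (fun v => if Nat.eqb v y' then e * q y v else 0))
      by (now rewrite sumV_delta).
    unfold Lap. rewrite <- sumV_minus. apply sumV_le. intros v hv.
    destruct (hq y v hy hv) as [hp|hz]; [|rewrite <- hz; destruct (Nat.eqb v y'); lra].
    specialize (f_le_G v hv (dist_adj n q hc y v hy hv hp)). unfold G in f_le_G.
    destruct (Nat.eqb v y'); nra. }
  unfold e in *. nra.
Qed.

(** Maximum principle on pairs: where the excess of [u x - u y] over the modulus is maximal,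
    [Lap_touching] bounds the difference of Laplacians, and the resolvent equation turns this into a
    sign for the excess. *)
Lemma resolvent_modulus lam qmin r u g :
  0 < lam -> 0 < qmin ->
  (forall x y, inV n x -> inV n y -> 0 < q x y -> qmin <= q x y) ->
  0 < r < 1 -> 2 * qmin * (1 - r) ^ 2 = lam * r ->
  (forall x, inV n x -> 0 <= g x <= 1) ->
  (forall x, inV n x -> lam * u x - Lap n q u x = lam * g x) ->
  forall x y, inV n x -> inV n y -> u x - u y <= 1 - r ^ d x y.
Proof.
  intros hlam hm hqm hr hE hg hu x0 y0 hx0 hy0.
  destruct (argmax (nat * nat) (list_prod (seq 0 n) (seq 0 n))
    (fun p => u (fst p) - u (snd p) - (1 - r ^ d (fst p) (snd p)))) as [[x y] [hxy hmax]].
  { intros E. assert (h : In (x0, y0) nil); [|exact h].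
    rewrite <- E. apply in_prod; apply in_seq; unfold inV in *; lia. }
  apply in_prod_iff in hxy. rewrite !in_seq in hxy. cbn [fst snd] in hmax.
  assert (hx : inV n x) by (unfold inV; lia). assert (hy : inV n y) by (unfold inV; lia).
  assert (hmax' : forall v w, inV n v -> inV n w ->
    u v - u w - (1 - r ^ d v w) <= u x - u y - (1 - r ^ d x y)).
  { intros v w hv hw. apply (hmax (v, w)). apply in_prod; apply in_seq; unfold inV in *; lia. }
  cut (u x - u y - (1 - r ^ d x y) <= 0).
  { specialize (hmax' x0 y0 hx0 hy0). lra. }
  destruct (Nat.eq_dec x y) as [<-|ne].
  { rewrite dist_refl by assumption. cbn. lra. }
  destruct (dist_descend n q hc x y hx hy ne) as [x' [hx' [qx' dx']]].
  destruct (dist_descend n q hc y x hy hx (not_eq_sym ne)) as [y' [hy' [qy' dy']]].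
  rewrite (dist_sym n q hc hsym y x hy hx) in dy'.
  pose proof (dist_pos n q hc x y hx hy ne) as hd.
  (* The slopes fed to [Lap_touching] are those of the two tangents of the modulus at [d x y = S D]:
     [a = r ^ D * (1 - r)] and [b = r ^ S D * (1 - r)]. Maximality of the excess transfers the
     tangent bounds to [u]. *)
  assert (H : Lap n q u x - Lap n q u y <=
    - (r ^ Nat.pred (d x y) * (1 - r) - r ^ d x y * (1 - r)) * (q x x' + q y y')).
  { destruct (d x y) as [|D] eqn:ED; [lia|]. cbn [Nat.pred].
    assert (p0 : 0 < r ^ D) by (apply pow_lt; lra).
    apply Lap_touching; rewrite ?ED; auto.
    - rewrite <- tech_pow_Rmult. assert (0 < r ^ D * (1 - r)) by (apply Rmult_lt_0_compat; lra).
      split; [rewrite Rmult_assoc; apply Rmult_lt_0_compat; lra|]. nra.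
    - intros v w hv hw. specialize (hmax' v w hv hw).
      destruct (geometric_tangents r D (d v w) hr). lra.
    - intros v w hv hw. specialize (hmax' v w hv hw).
      destruct (geometric_tangents r D (d v w) hr). lra. }
  (* Since [a - b = r ^ D * (1 - r) ^ 2] and the two rates sum to at least [2 * qmin], the equation
     defining [r] produces exactly [lam * r ^ S D]. *)
  assert (H2 : Lap n q u x - Lap n q u y <= - lam * r ^ d x y).
  { eapply Rle_trans; [exact H|]. destruct (d x y) as [|D]; [lia|]. cbn [Nat.pred].
    rewrite <- tech_pow_Rmult. assert (p0 : 0 < r ^ D) by (apply pow_lt; lra).
    pose proof (hqm x x' hx hx' qx'). pose proof (hqm y y' hy hy' qy').
    assert (0 <= r ^ D * (1 - r) ^ 2) by (apply Rmult_le_pos; [lra|apply pow2_ge_0]).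
    assert (r ^ D * (1 - r) ^ 2 * (2 * qmin) <= r ^ D * (1 - r) ^ 2 * (q x x' + q y y'))
      by (apply Rmult_le_compat_l; lra).
    assert (r ^ D * (2 * qmin * (1 - r) ^ 2) = r ^ D * (lam * r)) by (now rewrite hE).
    nra. }
  pose proof (hu x hx). pose proof (hu y hy). pose proof (hg x hx). pose proof (hg y hy).
  apply Rmult_le_reg_l with lam; [assumption|]. nra.
Qed.
End Curvature.

(** * Dirichlet form and Poincare inequality *)

Section Reversible.
Context (n : nat) (q : nat -> nat -> R) (m : nat -> R) (hq : rates_nonneg n q)
  (hrev : reversible n q m) (hc : connected n q).

Definition inner (f g : nat -> R) : R := sumV n (fun x => m x * (f x * g x)).

(** The sum runs over ordered pairs, so this is twice the usual Dirichlet form; hence the factors 2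
    below. *)
Definition energy (f g : nat -> R) : R :=
  sumV n (fun x => sumV n (fun y => m x * q x y * ((f x - f y) * (g x - g y)))).

Lemma rate_pos_sym x y : inV n x -> inV n y -> 0 < q x y -> 0 < q y x.
Proof.
  intros hx hy h. destruct hrev as [hm hr]. specialize (hr x y hx hy).
  pose proof (hm x hx). pose proof (hm y hy).
  destruct (hq y x hy hx) as [|E]; [assumption|]. rewrite <- E in hr. nra.
Qed.

Lemma conductance_sym x y : inV n x -> inV n y -> m x * q x y = m y * q y x.
Proof. intros hx hy. destruct hrev as [_ hr]. specialize (hr x y hx hy). lra. Qed.

(** Symmetry of the conductances allows the two summation indices to be exchanged; adding the two
    resulting expressions gives the symmetric form. *)
Lemma green f g : 2 * inner (fun x => - Lap n q f x) g = energy f g.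
Proof.
  assert (E1 : inner (fun x => - Lap n q f x) g =
    sumV n (fun x => sumV n (fun y => m x * q x y * ((f x - f y) * g x)))).
  { apply sumV_ext; intros x _. unfold Lap.
    transitivity ((- (m x * g x)) * sumV n (fun y => q x y * (f y - f x))); [ring|].
    rewrite <- sumV_scal. apply sumV_ext; intros y _. ring. }
  assert (E2 : inner (fun x => - Lap n q f x) g =
    sumV n (fun x => sumV n (fun y => m x * q x y * ((f y - f x) * g y)))).
  { rewrite E1, sumV_swap. apply sumV_ext; intros x hx. apply sumV_ext; intros y hy.
    now rewrite (conductance_sym x y). }
  replace (2 * inner (fun x => - Lap n q f x) g)
    with (inner (fun x => - Lap n q f x) g + inner (fun x => - Lap n q f x) g) by ring.
  rewrite E1 at 1. rewrite E2, <- sumV_plus. apply sumV_ext; intros x _.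
  rewrite <- sumV_plus. apply sumV_ext; intros y _. ring.
Qed.

Lemma energy_sym f g : energy f g = energy g f.
Proof. apply sumV_ext; intros x _. apply sumV_ext; intros y _. ring. Qed.

Lemma conductance_nonneg x y : inV n x -> inV n y -> 0 <= m x * q x y.
Proof.
  intros hx hy. apply Rmult_le_pos; [|now apply hq]. left. now apply hrev.
Qed.

Lemma energy_nonneg f : 0 <= energy f f.
Proof.
  apply sumV_nonneg; intros x hx. apply sumV_nonneg; intros y hy.
  apply Rmult_le_pos; [now apply conductance_nonneg|apply Rle_0_sqr].
Qed.

Lemma Lap_total f : sumV n (fun x => m x * Lap n q f x) = 0.
Proof.
  assert (H := green f (fun _ => 1)).
  assert (E : energy f (fun _ => 1) = 0).
  { apply sumV_eq0; intros x _. apply sumV_eq0; intros; ring. }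
  rewrite E in H. unfold inner in H.
  assert (E' : sumV n (fun x => m x * (- Lap n q f x * 1)) =
    -1 * sumV n (fun x => m x * Lap n q f x)).
  { rewrite <- sumV_scal. apply sumV_ext; intros; ring. }
  rewrite E' in H. lra.
Qed.

(** Every summand is nonnegative, so each vanishes and [f] agrees across edges; walks carry this to
    all pairs. *)
Lemma energy_zero_const f : energy f f = 0 ->
  forall x y, inV n x -> inV n y -> f x = f y.
Proof.
  intros h0.
  assert (hedge : forall x y, inV n x -> inV n y -> 0 < q x y -> f x = f y).
  { intros x y hx hy hp.
    assert (pos : forall x y, inV n x -> inV n y ->
      0 <= m x * q x y * ((f x - f y) * (f x - f y))).
    { intros v w hv hw. apply Rmult_le_pos; [now apply conductance_nonneg|apply Rle_0_sqr]. }
    assert (h : m x * q x y * ((f x - f y) * (f x - f y)) <= 0).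
    { rewrite <- h0. unfold energy.
      eapply Rle_trans; [|apply (sumV_term_le n
        (fun x => sumV n (fun y => m x * q x y * ((f x - f y) * (f x - f y)))) x)]; auto.
      - apply (sumV_term_le n (fun y => m x * q x y * ((f x - f y) * (f x - f y)))); auto.
      - intros v hv. apply sumV_nonneg. auto. }
    assert (0 < m x * q x y) by (apply Rmult_lt_0_compat; [now apply hrev|assumption]).
    apply Rminus_diag_uniq, NNPP. intros hne. apply Rlt_0_sqr in hne. unfold Rsqr in hne.
    apply (Rlt_not_le _ _ (Rmult_lt_0_compat _ _ H hne) h). }
  intros x y hx hy. destruct (hc x y hx hy) as [k hw]. revert x hx hw.
  induction k as [|k IH]; intros x hx hw.
  - cbn in hw. apply Nat.eqb_eq in hw. now subst.
  - apply walkb_S in hw. destruct hw as [z [hz [hp hw]]].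
    rewrite (hedge x z) by assumption. auto.
Qed.

Lemma inner_nonneg f : 0 <= inner f f.
Proof.
  apply sumV_nonneg. intros x hx. apply Rmult_le_pos; [|apply Rle_0_sqr]. left. now apply hrev.
Qed.

Lemma square_le_inner f x : inV n x -> f x * f x <= / m x * inner f f.
Proof.
  intros hx. destruct hrev as [hm _]. pose proof (hm x hx).
  assert (h : m x * (f x * f x) <= inner f f).
  { apply (sumV_term_le n (fun x => m x * (f x * f x))); auto.
    intros v hv. apply Rmult_le_pos; [|apply Rle_0_sqr]. left. auto. }
  apply Rmult_le_reg_l with (m x); [assumption|].
  replace (m x * (/ m x * inner f f)) with (inner f f) by (field; lra). exact h.
Qed.

Lemma inner_zero f : inner f f = 0 -> forall x, inV n x -> f x = 0.
Proof. intros h x hx. pose proof (square_le_inner f x hx). rewrite h in *. nra. Qed.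

(** * Resolvents and the spectral gap *)

Lemma kernel_operator_bounded (B : nat -> nat -> R) :
  exists C, 0 < C /\
    forall f, inner (fun j => sumV n (fun k => B j k * f k)) f <= C * inner f f.
Proof.
  set (S := sumV n (fun j => sumV n (fun k => m j * Rabs (B j k) * (/ m j + / m k)))).
  assert (hS : 0 <= S).
  { apply sumV_nonneg; intros j hj. apply sumV_nonneg; intros k hk.
    destruct hrev as [hm _]. pose proof (hm j hj). pose proof (hm k hk).
    apply Rmult_le_pos; [apply Rmult_le_pos; [lra|apply Rabs_pos]|].
    apply Rplus_le_le_0_compat; left; now apply Rinv_0_lt_compat. }
  exists (S + 1). split; [lra|]. intros f. pose proof (inner_nonneg f) as hI.
  apply Rle_trans with (S * inner f f); [|nra].
  rewrite Rmult_comm. unfold S. rewrite <- sumV_scal. apply sumV_le. intros j hj.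
  replace (m j * (sumV n (fun k => B j k * f k) * f j))
    with ((m j * f j) * sumV n (fun k => B j k * f k)) by ring.
  rewrite <- !sumV_scal. apply sumV_le. intros k hk.
  pose proof (square_le_inner f j hj) as sj. pose proof (square_le_inner f k hk) as sk.
  destruct hrev as [hm _]. pose proof (hm j hj).
  assert (h1 : Rabs (f j * f k) <= (/ m j + / m k) * inner f f).
  { apply Rabs_le. split; nra. }
  assert (h2 : B j k * (f j * f k) <= Rabs (B j k) * ((/ m j + / m k) * inner f f)).
  { eapply Rle_trans; [apply Rle_abs|]. rewrite Rabs_mult.
    apply Rmult_le_compat_l; [apply Rabs_pos|exact h1]. }
  apply Rmult_le_compat_l with (r := m j) in h2; lra.
Qed.

(** The rank-one term [c] times the total of [f] serves to move the eigenvalue on constants without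
    affecting functions of zero mean. The choice [c = 0] gives the plain resolvent. *)
Lemma resolvent_kernel (s c : R) :
  (forall f, (forall i, inV n i ->
      s * f i - Lap n q f i + c * sumV n (fun x => m x * f x) = 0) ->
    forall i, inV n i -> f i = 0) ->
  exists B : nat -> nat -> R, forall g i, inV n i ->
    let f := fun j => sumV n (fun k => B j k * g k) in
    s * f i - Lap n q f i + c * sumV n (fun x => m x * f x) = g i.
Proof.
  set (A := fun i j => (if Nat.eqb j i then s + sumV n (q i) else 0) - q i j + c * m j).
  assert (AE : forall f i, inV n i -> sumV n (fun j => A i j * f j) =
    s * f i - Lap n q f i + c * sumV n (fun x => m x * f x)).
  { intros f i hi. unfold A, Lap.
    rewrite (sumV_ext _ _ (fun j => (if Nat.eqb j i then (s + sumV n (q i)) * f j else 0)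
      + ((-1) * (q i j * f j) + c * (m j * f j)))).
    2:{ intros j _. destruct (Nat.eqb j i); ring. }
    rewrite sumV_plus, sumV_lin, sumV_delta by assumption.
    rewrite (sumV_ext _ (fun y => q i y * (f y - f i))
      (fun y => 1 * (q i y * f y) + (- f i) * q i y)) by (intros; ring).
    rewrite sumV_lin. change (sumV n (fun x => q i x)) with (sumV n (q i)). ring. }
  intros inj. destruct (LinAlg.right_inverse n A) as [B hB].
  - intros f hf. apply inj. intros i hi. rewrite <- AE; auto.
  - exists B. intros g i hi f. rewrite <- AE by assumption. now apply hB.
Qed.

Lemma inner_lin_l a b f g k :
  inner (fun x => a * f x + b * g x) k = a * inner f k + b * inner g k.
Proof. unfold inner. rewrite <- sumV_lin. apply sumV_ext; intros; ring. Qed.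

Lemma inner_sym f g : inner f g = inner g f.
Proof. apply sumV_ext; intros; ring. Qed.

Lemma energy_lin_l a b f g k :
  energy (fun x => a * f x + b * g x) k = a * energy f k + b * energy g k.
Proof.
  unfold energy. rewrite <- sumV_lin. apply sumV_ext; intros.
  rewrite <- sumV_lin. apply sumV_ext; intros; ring.
Qed.

Lemma inner_ext_l f g k : (forall x, inV n x -> f x = g x) -> inner f k = inner g k.
Proof. intros h. apply sumV_ext; intros x hx. now rewrite h. Qed.

Lemma inner_eq0_of_zero f g : (forall x, inV n x -> f x = 0) -> inner f g = 0.
Proof.
  intros h. apply sumV_eq0; intros x hx. rewrite h by assumption. ring.
Qed.

Context (hn : (0 < n)%nat).

Lemma total_mass_pos : 0 < sumV n m.
Proof.
  destruct hrev as [hm _]. apply Rlt_le_trans with (m 0%nat); [now apply hm|].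
  apply sumV_term_le; [|assumption]. intros x hx. left. auto.
Qed.

(* Cauchy-Schwarz for the semidefinite form [energy/2 - mu * inner], applied to [f] and
   its preimage under [-Lap - mu], turns invertibility into a strictly better bound. *)
Lemma spectral_gap_improves mu :
  (forall f, (forall x, inV n x -> - Lap n q f x = mu * f x) ->
     sumV n (fun x => m x * f x) = 0 -> forall x, inV n x -> f x = 0) ->
  (forall f, sumV n (fun x => m x * f x) = 0 -> 2 * mu * inner f f <= energy f f) ->
  exists e, 0 < e /\
    forall f, sumV n (fun x => m x * f x) = 0 -> 2 * (mu + e) * inner f f <= energy f f.
Proof.
  intros inj psd. pose proof total_mass_pos as hM.
  (* With this [c] the operator preserves the total [sumV n (fun x => m x * f x)], because
     [- mu + c * sumV n m = 1]; in particular preimages of mean-zero functions have mean zero. *)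
  set (c := (mu + 1) / sumV n m).
  assert (tot : forall f g, (forall i, inV n i ->
      - mu * f i - Lap n q f i + c * sumV n (fun x => m x * f x) = g i) ->
    sumV n (fun x => m x * f x) = sumV n (fun x => m x * g x)).
  { intros f g h.
    rewrite (sumV_ext n (fun x => m x * g x) (fun x =>
      (- mu * (m x * f x) + -1 * (m x * Lap n q f x)) + (c * sumV n (fun x => m x * f x)) * m x)).
    2:{ intros x hx. rewrite <- h by assumption. ring. }
    rewrite sumV_plus, sumV_lin, Lap_total, sumV_scal. unfold c. field. lra. }
  destruct (resolvent_kernel (- mu) c) as [B hB].
  { intros f hf. assert (h0 : sumV n (fun x => m x * f x) = 0).
    { rewrite (tot f (fun _ => 0) hf). apply sumV_eq0; intros; ring. }
    apply inj; [|assumption]. intros x hx. specialize (hf x hx). rewrite h0 in hf. lra. }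
  destruct (kernel_operator_bounded B) as [C [hC hbound]].
  exists (/ C). split; [now apply Rinv_0_lt_compat|]. intros f hf.
  set (g := fun j => sumV n (fun k => B j k * f k)).
  assert (hg : forall i, inV n i ->
    - mu * g i - Lap n q g i + c * sumV n (fun x => m x * g x) = f i) by (intros; now apply hB).
  assert (g0 : sumV n (fun x => m x * g x) = 0) by (now rewrite (tot g f hg)).
  assert (hLg : forall k, energy g k - 2 * mu * inner g k = 2 * inner f k).
  { intros k. rewrite <- green.
    assert (E : inner f k = inner (fun x => - mu * g x + 1 * - Lap n q g x) k).
    { apply inner_ext_l. intros x hx. rewrite <- (hg x hx), g0. ring. }
    rewrite E, inner_lin_l. ring. }
  specialize (hbound f). fold g in hbound.
  (* For [Q = energy - 2 * mu * inner], [hLg] gives [Q g k = 2 * inner f k]. Expanding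
     [Q (f - t * g) >= 0] yields [Q f f >= 4 * t * inner f f - 2 * t ^ 2 * inner g f], and
     [t * C = 1] leaves [2 * t * inner f f]. *)
  set (t := / C). set (k := fun x => 1 * f x + - t * g x).
  assert (k0 : sumV n (fun x => m x * k x) = 0).
  { rewrite (sumV_ext _ _ (fun x => 1 * (m x * f x) + - t * (m x * g x))) by (intros; unfold k; ring).
    rewrite sumV_lin, hf, g0. ring. }
  pose proof (psd k k0) as hk. unfold k in hk.
  rewrite inner_lin_l, energy_lin_l in hk.
  rewrite (inner_sym f), (inner_sym g), (energy_sym f), (energy_sym g) in hk.
  rewrite !inner_lin_l, !energy_lin_l in hk.
  rewrite (inner_sym f g), (energy_sym f g) in hk.
  pose proof (hLg f) as h1. pose proof (hLg g) as h2. rewrite (inner_sym f g) in h2.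
  fold t. assert (ht : t * C = 1) by (unfold t; field; lra).
  assert (htp : 0 < t) by (unfold t; now apply Rinv_0_lt_compat).
  assert (t * t * inner g f <= t * inner f f).
  { replace (t * inner f f) with (t * t * (C * inner f f)) by (replace (t * t * (C * inner f f)) with (t * (t * C) * inner f f) by ring; rewrite ht; ring).
    apply Rmult_le_compat_l; nra. }
  nra.
Qed.

(** Let [mu] be the best constant. The eigenfunction [f1] shows that it is at most [lam]. If it were
    smaller, it would not be a nonzero eigenvalue, and [spectral_gap_improves] would enlarge it. *)
Lemma poincare lam : is_lambda1 n q lam ->
  0 < lam /\
  forall f, sumV n (fun x => m x * f x) = 0 -> 2 * lam * inner f f <= energy f f.
Proof.
  intros [[f1 [[x1 [hx1 hf1]] heig]] [hlam0 hmin]].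
  assert (f1pos : 0 < inner f1 f1).
  { destruct (inner_nonneg f1) as [|E]; [assumption|].
    now destruct hf1; apply inner_zero. }
  assert (f1E : energy f1 f1 = 2 * lam * inner f1 f1).
  { rewrite <- green, (inner_ext_l _ (fun x => lam * f1 x + 0 * f1 x)), inner_lin_l; [ring|].
    intros x hx. rewrite heig by assumption. ring. }
  assert (f10 : sumV n (fun x => m x * f1 x) = 0).
  { apply Rmult_eq_reg_l with lam; [|assumption]. rewrite Rmult_0_r, <- sumV_scal.
    transitivity (sumV n (fun x => -1 * (m x * Lap n q f1 x))).
    - apply sumV_ext; intros x hx. specialize (heig x hx). nra.
    - rewrite sumV_scal, Lap_total. ring. }
  assert (hlam : 0 < lam).
  { pose proof (energy_nonneg f1). assert (0 <= lam) by nra. lra. }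
  split; [assumption|].
  set (P := fun mu => forall f, sumV n (fun x => m x * f x) = 0 ->
    2 * mu * inner f f <= energy f f).
  destruct (completeness P) as [mu [hub hlub]].
  { exists lam. intros mu hmu. specialize (hmu f1 f10). nra. }
  { exists 0. intros f _. pose proof (energy_nonneg f). lra. }
  assert (Pmu : P mu).
  { intros f hf. destruct (inner_nonneg f) as [hp|E].
    - apply Rnot_lt_le. intros hlt.
      assert (hle : mu <= energy f f / (2 * inner f f)).
      { apply hlub. intros nu hnu. specialize (hnu f hf).
        apply Rmult_le_reg_r with (2 * inner f f); [lra|]. unfold Rdiv.
        rewrite Rmult_assoc, Rinv_l by lra. lra. }
      apply Rmult_le_compat_r with (r := 2 * inner f f) in hle; [|lra].
      unfold Rdiv in hle. rewrite Rmult_assoc, Rinv_l in hle by lra. lra.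
    - rewrite <- E. pose proof (energy_nonneg f). lra. }
  destruct (Rle_lt_dec lam mu) as [hle|hlt].
  { intros f hf. specialize (Pmu f hf). pose proof (inner_nonneg f). nra. }
  exfalso. destruct (spectral_gap_improves mu) as [e [he hP]]; [|exact Pmu|].
  - intros f hf f0 x hx. destruct (Req_dec (f x) 0) as [|hnz]; [assumption|]. exfalso.
    (* Minimality of [lam] concerns nonzero eigenvalues only. At [mu = 0] the function [f] has zero
       energy, so it is constant, and its zero mean makes it vanish. *)
    destruct (Req_dec mu 0) as [->|hmu].
    + assert (hE : energy f f = 0).
      { rewrite <- green, (inner_eq0_of_zero _ f); [ring|].
        intros y hy. rewrite hf by assumption. ring. }
      rewrite (sumV_ext _ _ (fun y => f x * m y)), sumV_scal in f0.
      2:{ intros y hy. rewrite (energy_zero_const f hE y x hy hx). ring. }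
      pose proof total_mass_pos. apply Rmult_integral in f0. destruct f0; lra.
    + assert (lam <= mu); [|lra]. apply hmin; [|assumption].
      exists f. split; [eauto|assumption].
  - assert (mu + e <= mu); [|lra]. apply hub. exact hP.
Qed.
End Reversible.

(** * Cheeger constant *)

(** The set of positive rates is finite and, given an edge, nonempty; its infimum is attained and
    hence positive. *)
Lemma qmin_spec n q qmin :
  is_qmin n q qmin -> (exists x y, inV n x /\ inV n y /\ 0 < q x y) ->
  0 < qmin /\ forall x y, inV n x -> inV n y -> 0 < q x y -> qmin <= q x y.
Proof.
  intros [hlow hgreat] [x0 [y0 [hx0 [hy0 h0]]]].
  set (l := filter (fun p => adjb q (fst p) (snd p)) (list_prod (seq 0 n) (seq 0 n))).
  assert (lE : forall x y, inV n x -> inV n y -> 0 < q x y -> In (x, y) l).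
  { intros x y hx hy h. apply filter_In. split; [|now apply adjbP].
    apply in_prod; apply in_seq; unfold inV in *; lia. }
  destruct (argmax (nat * nat) l (fun p => - q (fst p) (snd p))) as [[x1 y1] [h1 hmin]].
  { intros E. pose proof (lE x0 y0 hx0 hy0 h0) as h. now rewrite E in h. }
  apply filter_In in h1. destruct h1 as [_ h1]. apply adjbP in h1. cbn [fst snd] in *.
  split.
  - apply Rlt_le_trans with (q x1 y1); [assumption|]. apply hgreat.
    intros s [x [y [hx [hy [h ->]]]]]. specialize (hmin (x, y) (lE x y hx hy h)). cbn in hmin. lra.
  - intros x y hx hy h. apply hlow. exists x, y. auto.
Qed.

Lemma eigenvalue_nonzero_edge n q lam :
  rates_nonneg n q -> is_eigenvalue n q lam -> lam <> 0 ->
  exists x y, inV n x /\ inV n y /\ 0 < q x y.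
Proof.
  intros hq [f [[x [hx hf]] heig]] hlam. apply NNPP. intros hno.
  assert (h : lam * f x = 0).
  { rewrite <- heig by assumption. unfold Lap. rewrite sumV_eq0; [ring|].
    intros y hy. destruct (hq x y hx hy) as [h|<-]; [|ring].
    destruct hno. exists x, y. auto. }
  apply Rmult_integral in h. tauto.
Qed.

(* [r] is the smaller root of [r^2 - (2 + t) r + 1]. *)
Lemma decay_rate t : 0 < t -> exists r, 0 < r < 1 /\ (1 - r) ^ 2 = t * r /\ 1 - r <= sqrt t.
Proof.
  intros ht. set (w := sqrt (t * t + 4 * t)).
  assert (w2 : w * w = t * t + 4 * t) by (apply sqrt_sqrt; nra).
  assert (w0 : 0 <= w) by apply sqrt_pos.
  assert (t < w < 2 + t) by (split; nra).
  exists ((2 + t - w) / 2).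
  assert (hr : 0 < (2 + t - w) / 2 < 1) by lra.
  assert (E : (1 - (2 + t - w) / 2) ^ 2 = t * ((2 + t - w) / 2)) by nra.
  repeat split; [lra|lra|assumption|]. revert hr E. generalize ((2 + t - w) / 2) as r. intros r hr E.
  rewrite <- (sqrt_pow2 (1 - r)) by lra. apply sqrt_le_1_alt. nra.
Qed.

(** Only pairs separated by [A] contribute, each in both orders. Edges being symmetric, the
    one-sided bound on [u x - u y] controls both signs. *)
Lemma boundary_energy n q m s u (A : nat -> bool) :
  rates_nonneg n q -> reversible n q m ->
  (forall x y, inV n x -> inV n y -> 0 < q x y -> u x - u y <= s) ->
  energy n q m u (fun x => if A x then 1 else 0) <= 2 * (s * boundary n q m A).
Proof.
  intros hq hrev hu.
  set (b := fun x y : nat => if A x then (if A y then 0 else m x * q x y) else 0).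
  assert (bE : boundary n q m A = sumV n (fun x => sumV n (fun y => b x y))).
  { apply sumV_ext; intros x _. unfold b. destruct (A x); [reflexivity|].
    symmetry. now apply sumV_eq0. }
  assert (E : 2 * (s * boundary n q m A) =
    sumV n (fun x => sumV n (fun y => s * (b x y + b y x)))).
  { replace (2 * (s * boundary n q m A))
      with (s * (boundary n q m A + boundary n q m A)) by ring.
    rewrite bE at 1. rewrite bE. rewrite (sumV_swap n n b) at 2.
    rewrite <- sumV_plus, <- sumV_scal.
    apply sumV_ext; intros x _. now rewrite <- sumV_plus, <- sumV_scal. }
  rewrite E. apply sumV_le; intros x hx. apply sumV_le; intros y hy. unfold b.
  pose proof (conductance_nonneg n q m hq hrev x y hx hy) as hw.
  pose proof (conductance_sym n q m hrev x y hx hy) as hws.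
  assert (hxy : m x * q x y * (u x - u y) <= m x * q x y * s).
  { destruct (hq x y hx hy) as [hp|<-]; [|lra]. apply Rmult_le_compat_l; auto. }
  assert (hyx : m x * q x y * (u y - u x) <= m x * q x y * s).
  { rewrite hws. destruct (hq y x hy hx) as [hp|<-]; [|lra].
    apply Rmult_le_compat_l; [rewrite <- hws|]; auto. }
  rewrite <- hws. destruct (A x), (A y); lra.
Qed.

(** Subtracting the common mean [c] from the indicator and from [u] gives [G] and [U] with
    [lam * U - Lap U = lam * G]. Then [energy u g = 2 * lam * (inner G G - inner G U)], to be
    bounded below by half of [lam * m(A)]. *)
Lemma cheeger_set_bound n q m s lam u (A : nat -> bool) :
  rates_nonneg n q -> reversible n q m -> connected n q -> (0 < n)%nat ->
  0 < lam ->
  (forall f, sumV n (fun x => m x * f x) = 0 -> 2 * lam * inner n m f f <= energy n q m f f) ->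
  (forall x, inV n x -> lam * u x - Lap n q u x = lam * (if A x then 1 else 0)) ->
  (forall x y, inV n x -> inV n y -> 0 < q x y -> u x - u y <= s) ->
  2 * mass n m A <= sumV n m ->
  lam * mass n m A <= 4 * (s * boundary n q m A).
Proof.
  intros hq hrev hc hn hlam hP hu hs hA.
  pose proof (total_mass_pos n q m hrev hn) as hM.
  pose proof (boundary_energy n q m s u A hq hrev hs) as hE.
  set (g := fun x => if A x then 1 else 0) in *.
  set (a := mass n m A) in *. set (M := sumV n m) in *.
  assert (ga : sumV n (fun x => m x * g x) = a).
  { apply sumV_ext; intros x _. unfold g. destruct (A x); ring. }
  assert (ua : sumV n (fun x => m x * u x) = a).
  { apply Rmult_eq_reg_l with lam; [|lra]. rewrite <- ga, <- !sumV_scal.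
    rewrite (sumV_ext _ (fun x => lam * (m x * g x))
      (fun x => lam * (m x * u x) + -1 * (m x * Lap n q u x))).
    - rewrite sumV_plus, (sumV_scal n (-1)), (Lap_total n q m hrev). ring.
    - intros x hx. specialize (hu x hx). fold (g x) in hu.
      transitivity (m x * (lam * g x)); [ring|]. rewrite <- hu. ring. }
  set (c := a / M). set (k := fun _ : nat => 1).
  assert (ik : forall f, inner n m f k = sumV n (fun x => m x * f x)).
  { intros f. apply sumV_ext; intros; unfold k; ring. }
  assert (gg : inner n m g g = a).
  { rewrite <- ga. apply sumV_ext; intros x _. unfold g. destruct (A x); ring. }
  set (G := fun x => 1 * g x + - c * k x). set (U := fun x => 1 * u x + - c * k x).
  assert (kk : inner n m k k = M) by (apply sumV_ext; intros; unfold k; ring).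
  assert (gk : inner n m g k = a) by (now rewrite ik).
  assert (uk : inner n m u k = a) by (now rewrite ik).
  assert (cM : c * M = a) by (unfold c; field; lra).
  assert (Uk : inner n m U k = 0) by (unfold U; rewrite inner_lin_l, uk, kk; lra).
  assert (Gk : inner n m G k = 0) by (unfold G; rewrite inner_lin_l, gk, kk; lra).
  assert (GG : inner n m G G = a - c * a).
  { unfold G at 1. rewrite inner_lin_l, (inner_sym n m k), Gk.
    rewrite (inner_sym n m g). unfold G. rewrite inner_lin_l, gg, (inner_sym n m k), gk. ring. }
  assert (res : forall f, inner n m (fun x => - Lap n q u x) f = lam * (inner n m G f - inner n m U f)).
  { intros f. rewrite (inner_ext_l n m _ (fun x => lam * G x + - lam * U x)), inner_lin_l; [ring|].
    intros x hx. specialize (hu x hx). fold (g x) in hu. unfold G, U. lra. }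
  assert (eU : energy n q m U U = 2 * lam * (inner n m G U - inner n m U U)).
  { rewrite <- green by assumption. rewrite Rmult_assoc, <- res. f_equal. apply inner_ext_l.
    intros x _. unfold Lap, U, k. f_equal. apply sumV_ext; intros; ring. }
  assert (eg : energy n q m u g = 2 * lam * (inner n m G G - inner n m U G)).
  { rewrite <- green by assumption. rewrite res.
    assert (Hs : forall f, inner n m f k = 0 -> inner n m f g = inner n m f G).
    { intros f hf. rewrite (inner_sym n m f G). unfold G. rewrite inner_lin_l, (inner_sym n m k), hf, (inner_sym n m g). ring. }
    rewrite (Hs G Gk), (Hs U Uk). ring. }
  assert (hPU : 2 * lam * inner n m U U <= energy n q m U U).
  { apply hP. now rewrite <- ik. }
  (* The Poincare inequality halves [U] relative to [G]: combined with the nonnegative square of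
     [G - 2 * U], this gives [inner G U <= inner G G / 2]. *)
  assert (h2 : 2 * inner n m U U <= inner n m G U).
  { rewrite eU in hPU. apply Rmult_le_reg_l with (2 * lam); lra. }
  assert (hsq : 0 <= inner n m (fun x => 1 * G x + - 2 * U x) (fun x => 1 * G x + - 2 * U x))
    by (now apply (inner_nonneg n q)).
  rewrite inner_lin_l, (inner_sym n m G), (inner_sym n m U), !inner_lin_l in hsq.
  rewrite (inner_sym n m U G) in *.
  (* This is where [A] having at most half the mass enters: [inner G G = a * (1 - c)] is then at
     least [a / 2]. *)
  assert (hc2 : 2 * c <= 1).
  { apply Rmult_le_reg_r with M; [assumption|]. lra. }
  assert (ha : 0 <= a).
  { unfold a. apply sumV_nonneg. intros x hx. destruct (A x); [left; now apply hrev|lra]. }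
  assert (a <= 2 * inner n m G G) by (rewrite GG; nra).
  assert (h3 : inner n m G G <= 2 * (inner n m G G - inner n m G U)) by lra.
  rewrite eg in hE. apply Rmult_le_compat_l with (r := lam) in h3; [|lra].
  apply Rmult_le_compat_l with (r := lam) in H; lra.
Qed.

Theorem mainTheorem13 (n : nat) (q : nat -> nat -> R) (m : nat -> R)
  (lam1 qmin h : R) :
  rates_nonneg n q ->
  reversible n q m ->
  connected n q ->
  nonneg_ollivier n q ->
  is_lambda1 n q lam1 ->
  is_qmin n q qmin ->
  is_cheeger n q m h ->
  lam1 <= 16 * ln 2 / qmin * h ^ 2.
Proof.
  intros hq hrev hc hk hlam hqm [_ hh].
  destruct (qmin_spec n q qmin hqm) as [hqp hqle].
  { apply (eigenvalue_nonzero_edge n q lam1); [assumption|apply hlam|apply hlam]. }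
  assert (hn : (0 < n)%nat).
  { destruct hlam as [[f [[x [hx _]] _]] _]. unfold inV in hx. lia. }
  destruct (poincare n q m hq hrev hc hn lam1 hlam) as [hlp hP].
  set (t := lam1 / (2 * qmin)).
  assert (ht : 0 < t) by (apply Rdiv_lt_0_compat; lra).
  destruct (decay_rate t ht) as [r [hr [hrE hrt]]].
  destruct (resolvent_kernel n q m lam1 0) as [B hB].
  { intros f hf. apply (inner_zero n q m hrev).
    pose proof (energy_nonneg n q m hq hrev f) as he. pose proof (inner_nonneg n q m hrev f) as hi.
    rewrite <- green, (inner_ext_l n m _ (fun x => - lam1 * f x + 0 * f x)), inner_lin_l in he
      by (try assumption; intros x hx; specialize (hf x hx); lra).
    nra. }
  (* Substituting [lam1 = 2 * qmin * t] into [lam1 * m(A) <= 4 * sqrt t * |dA|] and cancelling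
     [4 * sqrt t] bounds every Cheeger quotient from below by this constant. *)
  assert (hlow : sqrt t * qmin / 2 <= h).
  { apply hh. intros s [A [[x [hx hxA]] [hA ->]]].
    set (g := fun x => if A x then 1 else 0).
    set (u := fun j => sumV n (fun k => B j k * (lam1 * g k))).
    assert (hu : forall x, inV n x -> lam1 * u x - Lap n q u x = lam1 * g x).
    { intros z hz. pose proof (hB (fun z => lam1 * g z) z hz) as E.
      change (lam1 * u z - Lap n q u z + 0 * sumV n (fun x => m x * u x) = lam1 * g z) in E.
      lra. }
    assert (hosc : forall x y, inV n x -> inV n y -> 0 < q x y -> u x - u y <= sqrt t).
    { intros v w hv hw hvw.
      apply Rle_trans with (1 - r ^ Defs.dist n q v w).
      - apply (resolvent_modulus n q hq hc (rate_pos_sym n q m hq hrev) hk lam1 qmin r u g); auto.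
        + rewrite hrE. unfold t. field. lra.
        + intros z _. unfold g. destruct (A z); lra.
      - pose proof (dist_adj n q hc v w hv hw hvw) as hd.
        (* Distance 0 does occur, since a positive rate [q v v] is allowed; the modulus is then
           0. *)
        destruct (Defs.dist n q v w) as [|[|]]; [|cbn; lra|lia].
        cbn. pose proof (sqrt_pos t). lra. }
    pose proof (cheeger_set_bound n q m (sqrt t) lam1 u A hq hrev hc hn hlp hP hu hosc hA) as key.
    assert (hmass : 0 < mass n m A).
    { apply Rlt_le_trans with (if A x then m x else 0).
      - rewrite hxA. now apply hrev.
      - apply (sumV_term_le n (fun x => if A x then m x else 0)); [|assumption].
        intros z hz. destruct (A z); [left; now apply hrev|lra]. }
    assert (hst : 0 < sqrt t) by now apply sqrt_lt_R0.
    assert (E : lam1 = sqrt t * sqrt t * (2 * qmin)).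
    { rewrite sqrt_sqrt by lra. unfold t. field. lra. }
    apply Rmult_le_reg_r with (mass n m A); [assumption|].
    unfold Rdiv at 2. rewrite Rmult_assoc, Rinv_l, Rmult_1_r by lra.
    apply Rmult_le_reg_l with (4 * sqrt t); [lra|]. rewrite E in key at 1. lra. }
  assert (h2 : (sqrt t * qmin / 2) ^ 2 <= h ^ 2).
  { apply pow_incr. split; [|assumption]. pose proof (sqrt_pos t). nra. }
  replace ((sqrt t * qmin / 2) ^ 2) with (sqrt t * sqrt t * qmin ^ 2 / 4) in h2 by field.
  rewrite sqrt_sqrt in h2 by lra. unfold t in h2.
  replace (lam1 / (2 * qmin) * qmin ^ 2 / 4) with (lam1 * qmin / 8) in h2 by (field; lra).
  (* At this point [lam1 * qmin <= 8 * h ^ 2], and [/ 2 < ln 2] turns 8 into [16 * ln 2]. *)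
  pose proof ln_lt_2 as hln. pose proof (pow2_ge_0 h) as hp.
  apply Rmult_le_reg_r with qmin; [assumption|].
  replace (16 * ln 2 / qmin * h ^ 2 * qmin) with (16 * (ln 2 * h ^ 2)) by (field; lra).
  nra.
Qed.
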